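(* Let $a\in\mathbb{N}$, let $r\in\mathbb{N}_0$ with $r<a$, let $n=a+r$, and let $m\in\mathbb{N}_0$ be such that $n\geq m\geq r$. If $\gcd(a,m)=1$ and $\gcd(a,m-j)\mid n$ for all $j=1,\ldots,r$, then $A(1,a;n,m)\in\mathbb{N}_0[q]$.
   Context: $\mathbb{N}$ is the set of positive integers and $\mathbb{N}_0=\mathbb{N}\cup\{0\}$. $\mathbb{N}_0[q]$ is the set of polynomials in the indeterminate $q$ with nonnegative integer coefficients. Let $(q;q)_0=1$ and $(q;q)_n=\prod_{i=1}^{n}(1-q^i)$. For $m,n\in\mathbb{N}_0$ the $q$-binomial coefficient is $\left[{n\atop m}\right]=\frac{(q;q)_n}{(q;q)_m(q;q)_{n-m}}$ if $n\geq m\geq 0$, and $0$ otherwise. For $a\in\mathbb{N}$ and $b,m,n\in\mathbb{N}_0$ define the rational function of $q$ $$A(b,a;n,m)=\frac{1-q^b}{1-q^a}\left[{n\atop m}\right].$$ The statement $A(b,a;n,m)\in\mathbb{N}_0[q]$ means that this rational function is a polynomial in $q$ with nonnegative integer coefficients. *)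

(* Defs.v *)
From HB Require Import structures.
From mathcomp Require Import all_boot all_order all_algebra.

Set Implicit Arguments.
Unset Strict Implicit.
Unset Printing Implicit Defensive.

Import Order.TTheory GRing.Theory Num.Theory.
Local Open Scope ring_scope.

(* Rational functions of q are the fraction field of Z[q], i.e. Q(q); the
   indeterminate q is the polynomial variable 'X. *)
Notation ratfun := {fraction {poly int}}.

Definition qvar : ratfun := tofrac 'X.

Definition qpoch (n : nat) : ratfun := \prod_(1 <= i < n.+1) (1 - qvar ^+ i).

Definition qbinom (n m : nat) : ratfun :=
  if (m <= n)%N then qpoch n / (qpoch m * qpoch (n - m)) else 0.

(* A(b,a;n,m), meant for a > 0 only: at a = 0 the denominator vanishes. *)
Definition A (b a n m : nat) : ratfun :=
  (1 - qvar ^+ b) / (1 - qvar ^+ a) * qbinom n m.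

Definition in_N0q (f : ratfun) : Prop :=
  exists2 p : {poly int}, p \is a polyOver Num.nneg & f = tofrac p.

(* Main.v *)
Require Import Defs.
From mathcomp Require Import all_boot all_order all_algebra all_fingroup.
From mathcomp Require Import all_field.
From mathcomp Require Import zify ring realalg.

Set Implicit Arguments.
Unset Strict Implicit.
Unset Printing Implicit Defensive.

Import Order.TTheory GRing.Theory Num.Theory.
Local Open Scope ring_scope.

(** The rational function of the theorem is
    [f = (1 - q) / (1 - q^a) * [n, m]], where [[n, m]] is the Gaussian
    polynomial. That [f] is a polynomial and that its coefficients are
    nonnegative are two separate facts.

    Divisibility. By the factorization of [q^i - 1] into cyclotomic
    polynomials, [[n, m]] is the product of the [Phi_d] over those [d] for which
    adding [m mod d] and [(n - m) mod d] produces a carry. If [d > 1] divides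
    [a] and there is no carry, then [j = m mod d] is at most
    [n mod d = r mod d <= r]; it is positive since [a] and [m] are coprime; and
    [d] divides [gcd (a, m - j)], hence [n], so that [n mod d = 0 < j], a
    contradiction. Hence every [Phi_d] with [d | a] and [d > 1] occurs in
    [[n, m]], and their product is [(q^a - 1) / (q - 1)]
    ([gauss_divisible]).

    Nonnegativity. The coefficients of [[n, m]] are unimodal
    ([gauss_unimodal]), so those of [(1 - q) [n, m]] are first nonnegative, then
    nonpositive. Comparing coefficients in [(1 - q^a) f = (1 - q) [n, m]], the
    coefficients of [f] are nonnegative in the first range, by the recursion
    from [i - a] to [i], and in the second one by the recursion from [i + a]
    down to [i], which starts from the zero coefficients beyond the degree
    ([coef_quot_ge0]).

    Unimodality. The coefficients of [[n, m]] count the [m]-subsets of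
    [{0, ..., n - 1}] by the sum of their elements ([coef_gauss]). The functions
    on these subsets form the exterior power [Lambda^m] of the irreducible
    representation of [sl_2] of dimension [n]. In an orthonormal basis the
    raising and lowering operators are adjoint to each other, and their
    commutator acts on the [m]-subsets of sum [k] as the scalar
    [m (n - 1) - 2 k] ([lower_raise], [sum_weight_gap]). While this scalar is
    positive, the identity [|raise v|^2 = |lower v|^2 + scalar * |v|^2] shows
    that raising is injective ([raise_injective]), so there are at least as many
    [m]-subsets of sum [k + 1] as of sum [k] ([card_level_leS]). The reflection
    [x -> n - 1 - x] gives the decreasing half. *)

(** * Unimodality of the subset sums *)

(** The linear map with matrix [M], injective from the functions supported on
    [A] to the restrictions to [B], is taken on functions on the whole type, so
    that the lemma applies to an operator that maps one graded piece to the
    next without naming the pieces. *)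
Lemma leq_card_of_injective (F : fieldType) (T : finType) (A B : {set T})
    (M : T -> T -> F) :
    (forall v : T -> F, (forall x, x \notin A -> v x = 0) ->
       (forall y, y \in B -> \sum_x v x * M x y = 0) -> forall x, v x = 0) ->
  (#|A| <= #|B|)%N.
Proof.
move=> injM.
pose N : 'M[F]_(#|A|, #|B|) := \matrix_(i, j) M (enum_val i) (enum_val j).
suff /eqP <-: row_free N by apply: rank_leq_col.
apply: inj_row_free => u uN0.
(* The extension of the row vector u by zero outside A. *)
pose v x := \sum_(i < #|A| | enum_val i == x) u 0 i.
have v_enum i : v (enum_val i) = u 0 i.
  by rewrite /v (big_pred1 i) // => j /=; rewrite (inj_eq enum_val_inj).
suff v0 x : v x = 0 by apply/rowP => i; rewrite mxE -v_enum v0.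
apply: injM => [y yA | y yB].
  rewrite /v big_pred0 // => i.
  by apply: contraNF yA => /eqP <-; apply: enum_valP.
have -> : \sum_x v x * M x y = (u *m N) 0 (enum_rank_in yB y).
  rewrite mxE; under eq_bigr do rewrite mulr_suml.
  rewrite (exchange_big_dep xpredT) //=; apply: eq_bigr => i _.
  rewrite (big_pred1 (enum_val i)) => [|z]; last exact: eq_sym.
  by rewrite mxE enum_rankK_in.
by rewrite uN0 mxE.
Qed.

Lemma tperm_disjointC (T : finType) (a b d e y : T) :
    [/\ a != d, a != e, b != d & b != e] ->
  tperm a b (tperm d e y) = tperm d e (tperm a b y).
Proof.
case=> ad ae bd be; rewrite -!permM.
by rewrite (conjgC (tperm d e)) tpermJ !tpermD // eq_sym.
Qed.

Section Sl2.

Variables (R : rcfType) (p : nat).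
Implicit Types (S : {set 'I_p.+1}) (i j : 'I_p) (u v : {set 'I_p.+1} -> R).

Let lo i : 'I_p.+1 := widen_ord (leqnSn p) i.
Let hi i : 'I_p.+1 := lift ord0 i.

Let lo_neq i j : i != j -> lo i != lo j.
Proof. by []. Qed.

Let hi_neq i j : i != j -> hi i != hi j.
Proof. by rewrite (inj_eq lift_inj). Qed.

(** Exchanging the roles of [i] and [i + 1]; when exactly one of them lies in
    [S], this moves that element one step. *)
Definition swap i S : {set 'I_p.+1} := [set x | tperm (lo i) (hi i) x \in S].

Lemma swapK i : involutive (swap i).
Proof. by move=> S; apply/setP=> x; rewrite !inE tpermK. Qed.

Definition raisable i S := (lo i \in S) && (hi i \notin S).
Definition lowerable i S := (hi i \in S) && (lo i \notin S).

Lemma raisable_swap i S : raisable i (swap i S) = lowerable i S.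
Proof. by rewrite /raisable /lowerable !inE tpermL tpermR. Qed.

Lemma lowerable_swap i S : lowerable i (swap i S) = raisable i S.
Proof. by rewrite /raisable /lowerable !inE tpermL tpermR. Qed.

(** The matrix coefficients of the operators of [sl_2] on the irreducible
    representation of dimension [p + 1], in an orthonormal basis: raising and
    lowering between [i] and [i + 1] both have coefficient [x i], which makes
    them transposes of each other. *)
Let c i : R := (i.+1 * (p - i))%:R.
Let x i : R := Num.sqrt (c i).

Let sqr_x i : x i * x i = c i.
Proof. by rewrite -expr2 sqr_sqrtr // ler0n. Qed.

Definition raise v S := \sum_(i | lowerable i S) x i * v (swap i S).
Definition lower v S := \sum_(i | raisable i S) x i * v (swap i S).

Lemma raise_adjoint u v :
  \sum_S raise v S * u S = \sum_S v S * lower u S.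
Proof.
under eq_bigr do rewrite mulr_suml.
rewrite (exchange_big_dep xpredT) //=.
under [RHS]eq_bigr do rewrite mulr_sumr.
rewrite [RHS](exchange_big_dep xpredT) //=; apply: eq_bigr => i _.
rewrite (reindex_inj (inv_inj (swapK i))) /=.
apply: eq_big => [S | S _]; first by rewrite lowerable_swap.
by rewrite swapK; ring.
Qed.

(** Moves at two different places do not interfere: if the places overlap, both
    sides are false, since the shared position would have to be both occupied
    and free. *)
Lemma raise_lower_moveC i j S : i != j ->
  (raisable i S && lowerable j (swap i S)) =
  (lowerable j S && raisable i (swap j S)).
Proof.
rewrite /raisable /lowerable !inE => ij.
have [hlo hhi] := (lo_neq ij, hi_neq ij).
have [e|lihj] := eqVneq (lo i) (hi j).
  rewrite -e tpermL [tperm (lo j) _ _]tpermR.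
  by case: (hi i \in S); case: (lo j \in S); rewrite ?andbF ?andbT.
have [e|ljhi] := eqVneq (lo j) (hi i).
  rewrite e tpermR -e [tperm _ _ (lo j)]tpermL.
  by case: (hi j \in S); case: (lo j \in S); case: (lo i \in S);
    rewrite ?andbF ?andbT.
by rewrite !tpermD // 1?eq_sym // andbC.
Qed.

Lemma swapC i j S : i != j -> raisable i S -> lowerable j (swap i S) ->
  swap j (swap i S) = swap i (swap j S).
Proof.
rewrite /raisable /lowerable !inE => ij.
have [hlo hhi] := (lo_neq ij, hi_neq ij).
have [e|lihj] := eqVneq (lo i) (hi j).
  by rewrite -e tpermL => /andP[_ /negPf->].
have [e|ljhi] := eqVneq (lo j) (hi i).
  by rewrite e tpermR => /andP[-> _]; rewrite andbF.
move=> _ _; apply/setP=> y; rewrite !inE tperm_disjointC //.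
by split=> //; rewrite eq_sym.
Qed.

Definition weight (n : nat) (S : {set 'I_n}) : nat := \sum_(y in S) y.

(** The commutator is diagonal: the terms that move two different elements
    cancel, and only those that move an element back and forth remain. *)
Lemma lower_raise v S :
  lower (raise v) S - raise (lower v) S =
  (\sum_i c i * ((lo i \in S)%:R - (hi i \in S)%:R)) * v S.
Proof.
pose a i j := (raisable i S && lowerable j (swap i S))%:R
  * (x i * (x j * v (swap j (swap i S)))).
pose b i j := (lowerable j S && raisable i (swap j S))%:R
  * (x i * (x j * v (swap i (swap j S)))).
have -> : lower (raise v) S = \sum_i \sum_j a i j.
  rewrite [LHS]big_mkcond; apply: eq_bigr => i _; rewrite /a.
  case: (raisable i S); last by rewrite big1 // => j _; rewrite mul0r.
  rewrite mulr_sumr big_mkcond; apply: eq_bigr => j _ /=.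
  by case: ifP => _; rewrite ?mul1r ?mul0r.
have -> : raise (lower v) S = \sum_i \sum_j b i j.
  rewrite exchange_big [LHS]big_mkcond; apply: eq_bigr => j _; rewrite /b.
  case: (lowerable j S); last by rewrite big1 // => i _; rewrite mul0r.
  rewrite mulr_sumr big_mkcond; apply: eq_bigr => i _ /=.
  by case: ifP => _; rewrite ?mul1r ?mul0r //; ring.
have ab i j : i != j -> a i j = b i j.
  move=> ij; rewrite /a /b -raise_lower_moveC //.
  by case: andP => [[ri lj]|_]; rewrite ?mul0r // swapC.
rewrite -sumrB mulr_suml; apply: eq_bigr => i _.
rewrite -sumrB (bigD1 i) //= big1 ?addr0 => [|j ji]; last first.
  by rewrite ab ?subrr // eq_sym.
rewrite /a /b raisable_swap lowerable_swap !andbb swapK -(sqr_x i).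
rewrite /raisable /lowerable.
by case: (lo i \in S); case: (hi i \in S) => /=; ring.
Qed.

Lemma weight_sumE (n : nat) (S : {set 'I_n}) :
  (weight S)%:R = \sum_(y < n) y%:R * (y \in S)%:R :> R.
Proof.
rewrite natr_sum big_mkcond; apply: eq_bigr => y _.
by case: ifP; rewrite ?mulr1 ?mulr0.
Qed.

(** Summation by parts: [c y - c (y - 1) = p - 2 y], where [c] vanishes at both
    ends of the range. *)
Lemma sum_weight_gap S :
  \sum_i c i * ((lo i \in S)%:R - (hi i \in S)%:R) =
  (#|S| * p)%:R - (2 * weight S)%:R :> R.
Proof.
under eq_bigr do rewrite mulrBr.
rewrite sumrB.
(* The terms with coefficients [c y] and [c (y - 1)], over all positions; both
   coefficients vanish at the position that is missing on the left. *)
pose d (y : 'I_p.+1) : R := (y.+1 * (p - y))%:R * (y \in S)%:R.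
pose e (y : 'I_p.+1) : R := (y * (p.+1 - y))%:R * (y \in S)%:R.
have -> : \sum_i c i * (lo i \in S)%:R = \sum_y d y.
  by rewrite [RHS]big_ord_recr /= /d /= subnn muln0 mul0r addr0.
have -> : \sum_i c i * (hi i \in S)%:R = \sum_y e y.
  by rewrite [RHS]big_ord_recl /= /e /= mul0n mul0r add0r.
have cardE : #|S|%:R = \sum_(y < p.+1) (y \in S)%:R :> R.
  by rewrite -sum1_card natr_sum big_mkcond; apply: eq_bigr => y _; case: ifP.
rewrite !natrM weight_sumE cardE mulr_suml mulr_sumr.
rewrite -!sumrB; apply: eq_bigr => y _; rewrite /d /e.
have yp := ltn_ord y.
have -> : ((y.+1 * (p - y))%:R = (y * (p.+1 - y))%:R + p%:R - 2 * y%:R :> R).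
  have -> : (y * (p.+1 - y) = y * (p - y) + y)%N by nia.
  by rewrite mulSn !natrD natrB; [ring | lia].
by case: (y \in S); ring.
Qed.

Lemma card_swap i S : #|swap i S| = #|S|.
Proof. exact/(@card_preimset _ (tperm (lo i) (hi i)))/perm_inj. Qed.

Lemma weight_swap i S : lowerable i S -> weight S = (weight (swap i S)).+1.
Proof.
case/andP=> hS lS; rewrite /weight.
have -> : (\sum_(y in swap i S) y = \sum_(y in S) tperm (lo i) (hi i) y)%N.
  rewrite (reindex_inj (@perm_inj _ (tperm (lo i) (hi i)))) /=.
  by apply: eq_bigl => y; rewrite inE tpermK.
rewrite (bigD1 (hi i)) // [in RHS](bigD1 (hi i)) //= tpermR /= /bump leq0n.
rewrite add1n addSn; congr (_ + _).+1%N; apply: eq_bigr => y /andP[yS yhi].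
by rewrite tpermD // eq_sym //; apply: contraNneq lS => <-.
Qed.

(** If [v] is supported on the [m]-subsets of sum [k] and [raise v = 0], then
    [0 = |raise v|^2 = |lower v|^2 + (m p - 2 k) |v|^2], a sum of nonnegative
    terms. *)
Lemma raise_injective (m k : nat) (v : {set 'I_p.+1} -> R) :
    (2 * k < m * p)%N ->
    (forall S, ~~ ((#|S| == m) && (weight S == k)) -> v S = 0) ->
    (forall S, (#|S| == m) && (weight S == k.+1) -> raise v S = 0) ->
  forall S, v S = 0.
Proof.
move=> kmp supp_v rv0.
have {}rv0 S : raise v S = 0.
  have [/rv0 //|lvl] := boolP ((#|S| == m) && (weight S == k.+1)).
  apply: big1 => i lS; rewrite supp_v ?mulr0 // card_swap.
  by move: lvl; rewrite (weight_swap lS) eqSS.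
pose gap : R := (m * p)%:R - (2 * k)%:R.
have gap_gt0 : 0 < gap by rewrite subr_gt0 ltr_nat.
have : \sum_S lower v S ^+ 2 + \sum_S gap * v S ^+ 2 = 0.
  under eq_bigr do rewrite expr2.
  rewrite -raise_adjoint -big_split big1 //= => S _.
  have -> : raise (lower v) S =
      - (\sum_i c i * ((lo i \in S)%:R - (hi i \in S)%:R)) * v S.
    rewrite mulNr -lower_raise [lower _ S]big1 ?sub0r ?opprK // => i _.
    by rewrite rv0 mulr0.
  rewrite sum_weight_gap /gap.
  have [/andP[/eqP-> /eqP->]|lvl] := boolP ((#|S| == m) && (weight S == k)).
    by ring.
  by rewrite supp_v //; ring.
move/eqP; rewrite paddr_eq0; last 2 first.
- by apply: sumr_ge0 => S _; apply: sqr_ge0.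
- by apply: sumr_ge0 => S _; rewrite mulr_ge0 ?sqr_ge0 ?ltW.
move=> /andP[_ /eqP/psumr_eq0P gv0] S; apply/eqP.
rewrite -sqrf_eq0 -(mulrI_eq0 _ (lregP (lt0r_neq0 gap_gt0))) gv0 // => S' _.
by rewrite mulr_ge0 ?sqr_ge0 ?ltW.
Qed.

End Sl2.

Definition level n (m k : nat) : {set {set 'I_n}} :=
  [set S : {set 'I_n} | (#|S| == m) && (weight S == k)].

(** Injectivity of raising turns into an inequality of cardinals. The
    coefficients are square roots of integers, hence the real algebraic numbers
    as scalars. *)
Lemma card_level_leS p m k :
  (2 * k < m * p)%N -> (#|level p.+1 m k| <= #|level p.+1 m k.+1|)%N.
Proof.
move=> kmp.
pose x (i : 'I_p) : realalg := Num.sqrt (i.+1 * (p - i))%:R.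
pose M S' S := \sum_(i | lowerable i S && (S' == swap i S)) x i.
apply: (@leq_card_of_injective _ _ _ _ M) => v supp_v ker_v.
apply: (raise_injective kmp) => S lvl; first by rewrite supp_v // inE.
have := ker_v S; rewrite inE lvl => /(_ isT) <-.
under [RHS]eq_bigr do rewrite mulr_sumr.
rewrite [RHS](exchange_big_dep (fun i => lowerable i S)) /=; last first.
  by move=> ? ? _ /andP[].
apply: eq_bigr => i lS.
rewrite (big_pred1 (swap i S)) => [|S' /=]; last by rewrite lS.
by rewrite mulrC.
Qed.

Lemma card_level_reflect p m k :
  (k <= m * p)%N -> #|level p.+1 m k| = #|level p.+1 m (m * p - k)|.
Proof.
move=> kmp; pose f (S : {set 'I_p.+1}) := (@rev_ord p.+1) @^-1: S.
have fK : involutive f by move=> S; apply/setP=> y; rewrite !inE rev_ordK.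
rewrite -(card_preimset _ (inv_inj fK)); apply: eq_card => S; rewrite !inE.
rewrite card_preimset; last exact: rev_ord_inj.
have [cS|//] := eqVneq #|S| m; rewrite /=.
have : (weight (f S) + weight S = m * p)%N.
  rewrite /weight [X in (X + _)%N](reindex_inj rev_ord_inj) /=.
  rewrite (eq_bigl (mem S)) => [|y]; last by rewrite inE rev_ordK.
  rewrite -big_split -cS -sum_nat_const; apply: eq_bigr => y _ /=.
  by rewrite subSS; have := ltn_ord y; lia.
by lia.
Qed.

Lemma card_level_geS p m k :
  (m * p < 2 * k.+1)%N -> (#|level p.+1 m k.+1| <= #|level p.+1 m k|)%N.
Proof.
move=> kmp; have [kle|klt] := leqP k.+1 (m * p).
  rewrite card_level_reflect // [leqRHS]card_level_reflect ?(ltnW kle) //.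
  have -> : (m * p - k = (m * p - k.+1).+1)%N by lia.
  by apply: card_level_leS; lia.
rewrite [leqLHS](_ : _ = 0)%N //; apply: eq_card0 => S; rewrite inE.
apply/negP => /andP[/eqP cS /eqP wS]; move: klt; rewrite -wS -cS ltnNge.
rewrite /weight -sum_nat_const leq_sum // => y _.
by rewrite -ltnS ltn_ord.
Qed.

(** * Gaussian polynomials *)

(** The outer variable marks the size of the subset, the inner one the sum of
    its elements. *)
Definition subset_gf (n : nat) : {poly {poly int}} :=
  \prod_(i < n) (('X^i)%:P * 'X + 1).

Lemma coef_subset_gf n m k : (subset_gf n)`_m`_k = #|level n m k|%:R.
Proof.
rewrite /subset_gf bigA_distr /=.
have term (S : {set 'I_n}) :
    \prod_i (if i \in S then ('X^i)%:P * 'X else 1) =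
    ('X^(weight S))%:P * 'X^#|S| :> {poly {poly int}}.
  rewrite -big_mkcond big_split /= prodr_const; congr (_ * _).
  by rewrite -rmorph_prod /weight -(big_morph _ (exprD 'X) (expr0 'X)).
under eq_bigr do rewrite term.
rewrite !coef_sum -sum1_card natr_sum big_mkcond [RHS]big_mkcond.
apply: eq_bigr => S _; rewrite coefCM coefXn inE /= eq_sym.
case: (#|S| == m); last by rewrite mulr0 coef0.
by rewrite mulr1 coefXn eq_sym; case: eqP.
Qed.

Lemma subset_gf_recr n m :
  (subset_gf n.+1)`_m.+1 = (subset_gf n)`_m.+1 + 'X^n * (subset_gf n)`_m.
Proof.
rewrite /subset_gf big_ord_recr /= mulrDr mulr1 coefD mulrCA coefCM coefMX /=.
by rewrite addrC.
Qed.

Lemma subset_gf0 n : (subset_gf n)`_0 = 1.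
Proof.
rewrite -horner_coef0 horner_prod big1 // => i _.
by rewrite hornerD hornerM hornerX mulr0 add0r hornerC.
Qed.

Lemma subset_gf_small n m : (n < m)%N -> (subset_gf n)`_m = 0.
Proof.
elim: n m => [|n IHn] [|m] //; first by rewrite /subset_gf big_ord0 coef1.
by move=> nm; rewrite subset_gf_recr !IHn ?mulr0 ?addr0 // ltnW.
Qed.

(** Up to the sign [(-1)^n], the [q]-factorial [(q; q)_n]; the factors
    [q^i - 1] are the products of cyclotomic polynomials. *)
Definition pochX (n : nat) : {poly int} := \prod_(1 <= i < n.+1) ('X^i - 1).

Lemma pochX0 : pochX 0 = 1.
Proof. by rewrite /pochX big_geq. Qed.

Lemma pochX_recr n : pochX n.+1 = pochX n * ('X^(n.+1) - 1).
Proof. by rewrite /pochX big_nat_recr. Qed.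

Lemma XnsubC1_neq0 n : (0 < n)%N -> 'X^n - 1 != 0 :> {poly int}.
Proof. by move=> n_gt0; rewrite -size_poly_gt0 -polyC1 size_XnsubC. Qed.

Lemma pochX_neq0 n : pochX n != 0.
Proof.
elim: n => [|n IHn]; first by rewrite pochX0 oner_eq0.
by rewrite pochX_recr mulf_neq0 ?XnsubC1_neq0.
Qed.

(** The [q]-binomial theorem, without division. *)
Lemma subset_gf_pochX n m : (m <= n)%N ->
  (subset_gf n)`_m * (pochX m * pochX (n - m)) = 'X^'C(m, 2) * pochX n.
Proof.
elim: n m => [|n IHn] [|m] // mn.
- by rewrite subset_gf0 pochX0 bin0n expr0 !mulr1.
- by rewrite subset_gf0 subn0 bin0n expr0 pochX0 !mul1r.
rewrite subset_gf_recr mulrDl subSS binS bin1 exprD [pochX n.+1]pochX_recr.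
have -> : 'X^n * (subset_gf n)`_m * (pochX m.+1 * pochX (n - m)) =
    'X^'C(m, 2) * pochX n * ('X^n * ('X^(m.+1) - 1)).
  by rewrite pochX_recr -IHn //; ring.
move: mn; rewrite ltnS leq_eqVlt => /predU1P[->|mn].
  by rewrite subset_gf_small // mul0r add0r mulrACA.
have -> : (subset_gf n)`_m.+1 * (pochX m.+1 * pochX (n - m)) =
    'X^'C(m.+1, 2) * pochX n * ('X^(n - m) - 1).
  have -> : pochX (n - m) = pochX (n - m.+1) * ('X^(n - m) - 1).
    by rewrite -(subnSK mn) pochX_recr.
  by rewrite -IHn //; ring.
rewrite binS bin1 exprD.
have ring_id (u v w z x y : {poly int}) : y = w * z ->
    u * w * v * (z - 1) + u * v * (y * (x * w - 1)) = u * w * (v * (x * y - 1)).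
  by move->; ring.
by rewrite !exprS; apply: ring_id; rewrite -exprD subnKC // ltnW.
Qed.

(** The divisors of [k] as a condition on a range that does not depend on [k],
    so that products for different [k] can be multiplied termwise. *)
Lemma prod_Cyclotomic_dvd N k : (0 < k <= N)%N ->
  \prod_(1 <= d < N.+1 | (d %| k)%N) 'Phi_d = 'X^k - 1.
Proof.
case/andP=> k_gt0 kN; rewrite -prod_Cyclotomic // -big_filter.
apply: perm_big.
apply: uniq_perm; rewrite ?filter_uniq ?iota_uniq ?divisors_uniq // => d.
rewrite mem_filter mem_index_iota -dvdn_divisors //.
case: (boolP (d %| k)%N) => //= dk.
by rewrite (dvdn_gt0 k_gt0 dk) ltnS (leq_trans (dvdn_leq k_gt0 dk) kN).
Qed.

Lemma pochX_Cyclotomic N n : (n <= N)%N ->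
  pochX n = \prod_(1 <= d < N.+1) 'Phi_d ^+ (n %/ d).
Proof.
elim: n => [|n IHn] nN.
  by rewrite pochX0 big1_seq // => d _; rewrite div0n.
rewrite pochX_recr IHn ?(ltnW nN) // -(@prod_Cyclotomic_dvd N) //.
rewrite [X in _ * X]big_mkcond -big_split /=.
apply: eq_big_nat => d /andP[d_gt0 _].
by rewrite divnS // exprD mulrC; case: (d %| _)%N.
Qed.

(** The multiplicity of [Phi_d] in the Gaussian polynomial is
    [n / d - m / d - (n - m) / d], with integer quotients; it is 1 if
    adding [m mod d] and [(n - m) mod d] produces a carry, and 0 otherwise. *)
Definition carry (n m d : nat) := (d <= m %% d + (n - m) %% d)%N.

Definition gauss (n m : nat) : {poly int} :=
  \prod_(1 <= d < n.+1 | carry n m d) 'Phi_d.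

Lemma gauss_pochX n m : (m <= n)%N ->
  gauss n m * (pochX m * pochX (n - m)) = pochX n.
Proof.
move=> mn; rewrite !(@pochX_Cyclotomic n) ?leq_subr // /gauss big_mkcond.
rewrite -!big_split; apply: eq_big_nat => d /andP[d_gt0 _] /=.
rewrite -[in RHS](subnKC mn) divnD // !exprD -/(carry n m d) mulrC.
by case: (carry n m d).
Qed.

Lemma divf_eq (F : fieldType) (x y z : F) : y != 0 -> x = z * y -> x / y = z.
Proof. by move=> y0 ->; rewrite mulfK. Qed.

Lemma qbinomE n m : (m <= n)%N -> qbinom n m = tofrac (gauss n m).
Proof.
move=> mn; rewrite /qbinom mn.
have qpochE k : qpoch k = (-1) ^+ k * tofrac (pochX k).
  elim: k => [|k IHk].
    by rewrite /qpoch big_geq // pochX0 expr0 mul1r rmorph1.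
  rewrite [qpoch _]big_nat_recr // -/(qpoch k) IHk pochX_recr !rmorphM /=.
  by rewrite [in RHS]exprSr mulrACA mulN1r rmorphB rmorphXn rmorph1 opprB.
have nz k : qpoch k != 0.
  rewrite qpochE mulf_neq0 ?tofrac_eq0 ?pochX_neq0 //.
  by rewrite expf_neq0 // oppr_eq0 oner_eq0.
apply: divf_eq; first by rewrite mulf_neq0.
rewrite !qpochE -(gauss_pochX mn) -[in (-1) ^+ n](subnKC mn) exprD !rmorphM /=.
by rewrite mulrCA [in RHS]mulrACA.
Qed.

(** The shift [C(m, 2) = 0 + 1 + ... + (m - 1)] is the least sum of [m] distinct
    elements. *)
Lemma coef_gauss n m k : (m <= n)%N ->
  (gauss n m)`_k = #|level n m ('C(m, 2) + k)|%:R.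
Proof.
move=> mn; rewrite -coef_subset_gf.
suff -> : (subset_gf n)`_m = 'X^'C(m, 2) * gauss n m.
  by rewrite coefXnM ltnNge leq_addr addKn.
apply: (mulIf (mulf_neq0 (pochX_neq0 m) (pochX_neq0 (n - m)))).
by rewrite subset_gf_pochX // -mulrA gauss_pochX.
Qed.

Definition unimodal (f : {poly int}) :=
  exists t, (forall i, (i < t)%N -> f`_i <= f`_i.+1) /\
            (forall i, (t <= i)%N -> f`_i.+1 <= f`_i).

Lemma gauss_unimodal n m : (m <= n)%N -> unimodal (gauss n m).
Proof.
case: n => [|p] mn; rewrite /unimodal.
  exists 0%N; split=> // i _; move: mn; rewrite leqn0 => /eqP->.
  by rewrite /gauss big_geq // !coef1; case: i.
(* The degree is m (n - m), and the coefficients increase up to its half. *)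
exists (uphalf (m * (p.+1 - m))).
have h2 : (2 * 'C(m, 2) = m * m.-1)%N by rewrite -mul_bin_diag bin1.
have mp : (m * p = m * (p.+1 - m) + m * m.-1)%N.
  by case: (m) mn => // k kp; rewrite -mulnDr; congr (_ * _)%N; lia.
split=> i it; rewrite !coef_gauss // addnS ler_nat.
  by apply: card_level_leS; rewrite mulnDr mp h2; lia.
by apply: card_level_geS; rewrite mulnS mulnDr mp h2; lia.
Qed.

(** * Division of a Gaussian polynomial by [(q^a - 1) / (q - 1)] *)

(** Up to the mode [t] of [g], [f_i = f_(i-a) + (g_i - g_(i-1))] carries the
    sign upwards; beyond it, [f_i = f_(i+a) + (g_(i+a-1) - g_(i+a))] carries it
    downwards from the degree of [f]. *)
Lemma coef_quot_ge0 a (f g : {poly int}) : (0 < a)%N ->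
    unimodal g -> 0 <= g`_0 -> ('X^a - 1) * f = ('X - 1) * g ->
  forall i, 0 <= f`_i.
Proof.
move=> a_gt0 [t [incr decr]] g0 fg.
have coef_fg i : f`_i = (if (i < a)%N then 0 else f`_(i - a)) +
                       (g`_i - (if i is j.+1 then g`_j else 0)).
  have := congr1 (fun h : {poly int} => h`_i) fg.
  rewrite !mulrBl !mul1r !coefB coefXnM coefXM => e.
  rewrite -[LHS](subKr (if (i < a)%N then 0 else f`_(i - a))) e opprB.
  by case: i {e}.
have low i : (i <= t)%N -> 0 <= f`_i.
  elim/ltn_ind: i => i IH it; rewrite coef_fg addr_ge0 //.
    by case: ltnP => // ai; apply: IH; lia.
  by case: i it {IH} => [_|i it]; rewrite ?subr0 // subr_ge0 incr.
have high k i : (t < i)%N -> (size f - i <= k)%N -> 0 <= f`_i.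
  elim: k i => [|k IH] i ti sz.
    by rewrite nth_default // -subn_eq0 -leqn0.
  have := coef_fg (i + a)%N; rewrite ltnNge leq_addl /= addnK.
  rewrite -(prednK a_gt0) addnS; set b := a.-1 => e.
  rewrite -(addrK (g`_(i + b).+1 - g`_(i + b)) f`_i) -e opprB.
  by rewrite addr_ge0 ?subr_ge0 ?IH ?decr //; lia.
by move=> i; case: (leqP i t) => [/low | /high]//; apply.
Qed.

(** All [Phi_d] with [d | a] and [d > 1] divide the Gaussian polynomial: without
    a carry at [d], the divisibility hypothesis for [j = m mod d] would give
    [d | n], while [n mod d >= j > 0]. *)
Lemma gauss_divisible a r n m : (0 < a)%N -> n = (a + r)%N -> (m <= n)%N ->
    coprime a m ->
    (forall j, (1 <= j <= r)%N -> (gcdn a (m - j) %| n)%N) ->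
  exists f, ('X^a - 1) * f = ('X - 1) * gauss n m.
Proof.
move=> a_gt0 nE mn co_am dvd.
have carryP d : (d %| a)%N -> (1 < d)%N -> carry n m d.
  move=> da d_gt1; rewrite /carry leqNgt; apply/negP => nc.
  have d_gt0 := ltnW d_gt1.
  have nd : (n %% d = m %% d + (n - m) %% d)%N.
    by rewrite -{1}(subnKC mn) modnD // leqNgt nc subn0.
  have nr : (n %% d = r %% d)%N by rewrite nE -modnDml (eqP da) add0n.
  have j_gt0 : (0 < m %% d)%N.
    rewrite lt0n; apply/negP => dm.
    have : (d %| gcdn a m)%N by rewrite dvdn_gcd da.
    by rewrite (eqP co_am) dvdn1 => /eqP d1; rewrite d1 in d_gt1.
  have jr : (m %% d <= r)%N.
    by rewrite (leq_trans _ (leq_mod r d)) // -nr nd leq_addr.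
  have : (d %| n)%N.
    apply: (dvdn_trans _ (dvd (m %% d)%N _)); last by rewrite j_gt0.
    by rewrite dvdn_gcd da /= {1}(divn_eq m d) addnK dvdn_mull.
  by rewrite /dvdn nd; lia.
exists (\prod_(1 <= d < n.+1 | carry n m d && ~~ (d %| a)%N) 'Phi_d).
have Xa : \prod_(1 <= d < n.+1 | (d %| a)%N) 'Phi_d = 'X^a - 1.
  by apply: prod_Cyclotomic_dvd; rewrite a_gt0 nE leq_addr.
have X1 : \prod_(1 <= d < n.+1 | (d %| 1)%N) 'Phi_d = 'X - 1.
  rewrite -[X in _ = X - _]expr1; apply: prod_Cyclotomic_dvd.
  by rewrite nE addn_gt0 a_gt0.
rewrite /gauss [in RHS](bigID (fun d => d %| a)%N) /= mulrA; congr (_ * _).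
rewrite -Xa -X1 [in LHS](bigID (fun d => d %| 1)%N) /=.
congr (_ * _); apply: congr_big_nat => // d /andP[d_gt0 _].
  by rewrite dvdn1; have [->|_] := eqVneq d 1%N; rewrite ?andbF ?dvd1n.
rewrite dvdn1; have [->|d1] := eqVneq d 1%N.
  by rewrite andbF /carry !modn1.
case da: (d %| a)%N; last by rewrite andbF.
by rewrite carryP // ltn_neqAle eq_sym d1.
Qed.

Theorem theorem3 (a r n m : nat) (ha : (0 < a)%N) (hr : (r < a)%N)
    (hn : n = (a + r)%N) (hmn : (m <= n)%N) (hrm : (r <= m)%N)
    (hgcd : gcdn a m = 1%N)
    (hdvd : forall j : nat, (1 <= j <= r)%N -> (gcdn a (m - j) %| n)%N) :
  in_N0q (A 1 a n m).
Proof.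
have [f fE] := gauss_divisible ha hn hmn (introT eqP hgcd) hdvd.
exists f.
  apply/polyOverP => i; apply: coef_quot_ge0 fE i => //.
    exact: gauss_unimodal.
  by rewrite coef_gauss // ler0n.
have qE k : 1 - qvar ^+ k = - tofrac ('X^k - 1).
  by rewrite tofracB tofracXn tofrac1 opprB.
rewrite /A qbinomE // !qE mulrAC; apply: divf_eq.
  by rewrite oppr_eq0 tofrac_eq0 XnsubC1_neq0.
by rewrite mulrN mulNr -!tofracM [f * _]mulrC fE expr1.
Qed.
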